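(* Let $m>0$, $S>0$, and let $\mathrm{Ad}=\mathrm{Ad}(m,S)$ be the family of regular strings $dM$ with $0<\mathrm{Tm}_M\le m$ and $0\le\mathrm{Stm}_M\le S$. For $\alpha\in\mathbb{R}$ let $$\mathcal{I}(\alpha):=\inf\{\operatorname{Im}\kappa:\ \operatorname{Re}\kappa=\alpha \text{ and } \kappa\in K(dM)\text{ for some } dM\in \mathrm{Ad}\}.$$ If $S\le m^2/4$, then $$\mathcal{I}(\alpha)=\begin{cases} m^{-1}, & \alpha=0,\\ \sqrt{S^{-1}-\alpha^2}, & 0<|\alpha|\le S^{-1/2},\\ 0, & |\alpha|\ge S^{-1/2}.\end{cases}$$ If $S>m^2/4$, then $$\mathcal{I}(\alpha)=\begin{cases} m^{-1}, & \alpha=0,\\ m^{-1}+\sqrt{m^{-2}-\alpha^2}, & 0<|\alpha|<\sqrt{S^{-1}-m^2S^{-2}/4},\\ \sqrt{S^{-1}-\alpha^2}, & \sqrt{S^{-1}-m^2S^{-2}/4}\le|\alpha|\le S^{-1/2},\\ 0, & |\alpha|\ge S^{-1/2}.\end{cases}$$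
   Context: A (Krein) string is a locally bounded nonnegative Borel measure $dM$ on $(-\infty,1]$. Its total mass is $\mathrm{Tm}_M=\int_{(-\infty,1]}dM$ and its statical moment with respect to the right end is $\mathrm{Stm}_M=\int_{(-\infty,1]}(1-x)\,dM(x)$. The string is regular if $\operatorname{supp}dM$ is bounded from below; its left end $a_1$ is then the infimum of $\operatorname{supp} dM$ (with $a_1=1$ if $dM=0$). Quasi-eigenvalues of a regular string are the $\kappa\in\mathbb{C}$ for which $$-\frac{d^2}{dM\,dx}y(x)=\kappa^2y(x),\quad \partial_x^-y(a_1)=0,\quad y(1)=\frac{\mathrm{i}}{\kappa}\,\partial_x^+y(1)$$ has a nonzero solution $y$. The equation is understood in the integral sense: together with the left boundary condition it means $y(x)=c-\kappa^2\int_{(-\infty,x]}(x-s)y(s)\,dM(s)$ with a constant $c$, and $\partial_x^+y(1)=-\kappa^2\int_{(-\infty,1]}y(s)\,dM(s)$ (an atom of $dM$ at $1$ is included). Equivalently, the set $K(dM)$ of quasi-eigenvalues is the zero set of the entire function $$F(z)=\varphi(1,z)-\mathrm{i}\,\partial_x^+\varphi(1,z)/z=\varphi(1,z)+\mathrm{i}z\int_{(-\infty,1]}\varphi(s,z)\,dM(s),$$ where $\varphi(\cdot,z)$ is the solution of $\varphi(x,z)=1-z^2\int_{(-\infty,x]}(x-s)\varphi(s,z)\,dM(s)$. *)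

(* Defs.v *)
From mathcomp Require Import all_boot all_order all_algebra complex.
From mathcomp Require Import all_classical all_reals all_analysis.

Set Implicit Arguments.
Unset Strict Implicit.
Unset Printing Implicit Defensive.

Import Order.TTheory GRing.Theory Num.Theory.
Import numFieldNormedType.Exports.

Local Open Scope classical_set_scope.
Local Open Scope ring_scope.
Local Open Scope complex_scope.

(* A string lives on (-oo, 1]; it is encoded as a Borel measure on the whole
   line that does not charge (1, +oo). *)
Definition is_string (R : realType)
    (M : {measure set (measurableTypeR R) -> \bar R}) : Prop :=
  M `]1, +oo[%classic = 0%E /\ forall a : R, (M `[a, 1%R]%classic < +oo)%E.

Definition total_mass (R : realType)
    (M : {measure set (measurableTypeR R) -> \bar R}) : \bar R :=
  M `]-oo, 1]%classic.

Definition static_moment (R : realType)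
    (M : {measure set (measurableTypeR R) -> \bar R}) : \bar R :=
  (\int[M]_(x in `]-oo, 1%R]%classic) (1 - x)%:E)%E.

Definition supp (R : realType)
    (M : {measure set (measurableTypeR R) -> \bar R}) : set R :=
  [set x | forall U : set R, open U -> U x -> (0 < M U)%E].

Definition is_regular_string (R : realType)
    (M : {measure set (measurableTypeR R) -> \bar R}) : Prop :=
  is_string M /\ has_lbound (supp M).

Definition cintegrable (R : realType)
    (M : {measure set (measurableTypeR R) -> \bar R}) (D : set R)
    (f : R -> R[i]) : Prop :=
  M.-integrable D (fun x => (complex.Re (f x))%:E) /\
  M.-integrable D (fun x => (complex.Im (f x))%:E).

Definition cintegral (R : realType)
    (M : {measure set (measurableTypeR R) -> \bar R}) (D : set R)
    (f : R -> R[i]) : R[i] :=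
  (\int[M]_(x in D) complex.Re (f x)) +i* (\int[M]_(x in D) complex.Im (f x)).

(* The values of y to the right of 1 are irrelevant.  The integral equation
   incorporates the left boundary condition, c being the value of y to the left
   of the string.  Requiring y to be dM-integrable makes the integrals
   meaningful, because Rintegral is a total function; for a regular string it
   is no restriction on solutions, which are continuous and constant to the
   left of the string. *)
Definition is_solution (R : realType)
    (M : {measure set (measurableTypeR R) -> \bar R}) (kappa : R[i])
    (y : R -> R[i]) : Prop :=
  cintegrable M `]-oo, 1]%classic y /\
  exists c : R[i], forall x : R, x <= 1 ->
    y x = c - kappa ^+ 2 * cintegral M `]-oo, x]%classic (fun s => (x - s)%:C * y s).

(* The right derivative at 1 of a solution, an atom of M at 1 included. *)
Definition right_slope (R : realType)
    (M : {measure set (measurableTypeR R) -> \bar R}) (kappa : R[i])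
    (y : R -> R[i]) : R[i] :=
  - kappa ^+ 2 * cintegral M `]-oo, 1]%classic y.

(* K(dM).  The condition kappa != 0 makes i / kappa meaningful; with the
   convention 0^-1 = 0 it would follow from the remaining conditions. *)
Definition quasi_eigenvalues (R : realType)
    (M : {measure set (measurableTypeR R) -> \bar R}) : set R[i] :=
  [set kappa | kappa != 0 /\
     exists y : R -> R[i],
       [/\ is_solution M kappa y,
           y 1 = 'i%C / kappa * right_slope M kappa y &
           exists2 x : R, x <= 1 & y x != 0]].

Definition admissible (R : realType) (m S : R)
    (M : {measure set (measurableTypeR R) -> \bar R}) : Prop :=
  [/\ is_regular_string M,
      (0 < total_mass M <= m%:E)%E &
      (0 <= static_moment M <= S%:E)%E].

(* The infimum is taken in the extended reals, where it is never a default
   value: it is +oo on the empty set and -oo on sets unbounded below. *)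
Definition min_decay (R : realType) (m S alpha : R) : \bar R :=
  ereal_inf [set (complex.Im kappa)%:E | kappa in
    [set kappa : R[i] | complex.Re kappa = alpha /\
       exists M : {measure set (measurableTypeR R) -> \bar R},
         admissible m S M /\ quasi_eigenvalues M kappa]].

(* Main.v *)
(* Let kappa = alpha + i beta be a quasi-eigenvalue of M with solution y.  Since
   y(1) = (i/kappa) y'(1+) = - i kappa Y with Y the integral of y dM, integrating
   the equation from x to 1 turns it into
     y(x) = - i kappa Y + kappa^2 (G y)(x),
   where G is the integral operator on L^2(M) with kernel min(1 - s, 1 - x).
   G is positive and, by Cauchy-Schwarz, bounded by the static moment, while
   |Y|^2 <= M(R) |y|^2.  Pairing with y gives 1 = - i kappa b + kappa^2 a for some
   0 <= a <= S and 0 <= b <= m.  This is exactly the equation for a single point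
   mass b at distance a/b from 1, so point masses realise every admissible
   quasi-eigenvalue, and only planar geometry is left: for alpha != 0 the
   attainable kappa in the open upper half-plane are those outside the disc
   |kappa|^2 < 1/S and outside the disc |kappa - i/m| < 1/m. *)
Require Import Defs.
From mathcomp Require Import all_boot all_order all_algebra complex ring lra.
From mathcomp Require Import all_classical all_reals all_analysis.
From mathcomp Require Import measurable_realfun.

Set Implicit Arguments.
Unset Strict Implicit.
Unset Printing Implicit Defensive.

Import Order.TTheory GRing.Theory Num.Theory.
Import numFieldNormedType.Exports.
Local Open Scope classical_set_scope.
Local Open Scope ring_scope.
Local Open Scope complex_scope.

(** * Bounded functions against a finite measure, and the Cauchy-Schwarz inequality *)

Section BoundedMeasurable.
Context {d : measure_display} {T : measurableType d} {R : realType}.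
Implicit Types f g : T -> R.

(** This class is closed under sums and products and integrable against every finite measure, so it
    can be tracked in place of separate integrability conditions. *)
Definition bounded_measurable f :=
  measurable_fun setT f /\ exists C, forall x, `|f x| <= C.

Lemma bounded_measurable_cst (r : R) : bounded_measurable (fun=> r).
Proof. by split; [exact: measurable_cst | exists `|r|]. Qed.

Lemma bounded_measurableD f g : bounded_measurable f -> bounded_measurable g ->
  bounded_measurable (fun x => f x + g x).
Proof.
move=> [mf [C fC]] [mg [D gD]]; split; first exact: measurable_funD.
by exists (C + D) => x; rewrite (le_trans (ler_normD _ _))// lerD.
Qed.

Lemma bounded_measurableM f g : bounded_measurable f -> bounded_measurable g ->
  bounded_measurable (fun x => f x * g x).
Proof.
move=> [mf [C fC]] [mg [D gD]]; split; first exact: measurable_funM.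
by exists (C * D) => x; rewrite normrM ler_pM.
Qed.

Lemma bounded_measurable_sqr f : bounded_measurable f ->
  bounded_measurable (fun x => f x ^+ 2).
Proof.
move=> bf; have -> : (fun x => f x ^+ 2) = (fun x => f x * f x).
  by apply/funext => x; rewrite expr2.
exact: bounded_measurableM.
Qed.

Lemma bounded_measurable_restrict (D : set T) f : measurable D ->
  measurable_fun D f -> (exists C, forall x, D x -> `|f x| <= C) ->
  bounded_measurable (f \_ D).
Proof.
move=> mD mf [C fC]; split; first by apply/(measurable_restrictT _ mD).
exists `|C| => x; rewrite patchE; case: ifPn => [/set_mem/fC fx|_].
  exact: le_trans fx (ler_norm _).
by rewrite normr0.
Qed.

Lemma bounded_measurableZ (r : R) f : bounded_measurable f ->
  bounded_measurable (fun x => r * f x).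
Proof. by move=> bf; apply: bounded_measurableM (bounded_measurable_cst r) bf. Qed.

Variable mu : {finite_measure set T -> \bar R}.

Lemma bounded_measurable_integrable f : bounded_measurable f ->
  mu.-integrable setT (EFin \o f).
Proof.
move=> [mf [C fC]]; apply: measurable_bounded_integrable => //.
  by rewrite -ge0_fin_numE//; exact: fin_num_measure.
exists `|C|; split; first exact: num_real.
move=> y Cy x _; apply: le_trans (fC x) _.
exact: le_trans (ler_norm _) (ltW Cy).
Qed.

Lemma bounded_RintegralD f g : bounded_measurable f -> bounded_measurable g ->
  \int[mu]_x (f x + g x) = \int[mu]_x f x + \int[mu]_x g x.
Proof. by move=> bf bg; rewrite RintegralD//; exact: bounded_measurable_integrable. Qed.

Lemma bounded_RintegralZ r f : bounded_measurable f ->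
  \int[mu]_x (r * f x) = r * \int[mu]_x f x.
Proof. by move=> bf; rewrite RintegralZl//; exact: bounded_measurable_integrable. Qed.

Lemma bounded_le_Rintegral f g : bounded_measurable f -> bounded_measurable g ->
  (forall x, f x <= g x) -> \int[mu]_x f x <= \int[mu]_x g x.
Proof. by move=> bf bg fg; apply: le_Rintegral => //; exact: bounded_measurable_integrable. Qed.

(** The integral of the square of [a * f + b * g] is a quadratic form in [a] and [b] that is
    nonnegative everywhere; two choices of the coefficients suffice. *)
Lemma Rintegral_Cauchy_Schwarz f g : bounded_measurable f -> bounded_measurable g ->
  (\int[mu]_x (f x * g x)) ^+ 2 <=
  (\int[mu]_x (f x ^+ 2)) * (\int[mu]_x (g x ^+ 2)).
Proof.
move=> bf bg.
have bff : bounded_measurable (fun x => f x ^+ 2) by exact: bounded_measurable_sqr.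
have bgg : bounded_measurable (fun x => g x ^+ 2) by exact: bounded_measurable_sqr.
have bfg : bounded_measurable (fun x => f x * g x) by exact: bounded_measurableM.
set A := \int[mu]_x (f x ^+ 2); set B := \int[mu]_x (f x * g x).
set C := \int[mu]_x (g x ^+ 2).
have quad a b : 0 <= a ^+ 2 * A + (2 * a * b * B + b ^+ 2 * C).
  have -> : a ^+ 2 * A + (2 * a * b * B + b ^+ 2 * C) =
      \int[mu]_x ((a * f x + b * g x) ^+ 2).
    rewrite /A /B /C -!bounded_RintegralZ// -!bounded_RintegralD//.
    - by apply: eq_Rintegral => x _; ring.
    all: do ?[apply: bounded_measurableD | apply: bounded_measurableZ] => //.
  by apply: Rintegral_ge0 => x _; exact: sqr_ge0.
have A0 : 0 <= A by apply: Rintegral_ge0 => x _; exact: sqr_ge0.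
have [A_eq0|A_neq0] := eqVneq A 0.
  (* With [A] zero this choice gives [0 <= - (C + 2) * B ^+ 2], and the next one gives [0 <= C];
     together they force [B = 0]. *)
  have := quad (- (C + 1)) B; rewrite A_eq0 => H.
  have := quad 0 1; rewrite A_eq0 => H1.
  nra.
(* The direction that minimises the form for a fixed second coefficient. *)
have := quad B (- A) => H.
have {}A0 : 0 < A by rewrite lt_neqAle eq_sym A_neq0.
have : 0 <= A * (A * C - B ^+ 2).
  by have -> : A * (A * C - B ^+ 2) = B ^+ 2 * A + (2 * B * - A * B + (- A) ^+ 2 * C) by ring.
by rewrite pmulr_rge0// subr_ge0.
Qed.

End BoundedMeasurable.

(** * Fubini's theorem for bounded functions on a product of finite measures *)

Section BoundedFubini.
Local Open Scope ereal_scope.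
Context {d1 d2 : measure_display} {T1 : measurableType d1} {T2 : measurableType d2}
  {R : realType}.
Variables (mu : {finite_measure set T1 -> \bar R}) (nu : {finite_measure set T2 -> \bar R}).
Variable f : T1 * T2 -> R.
Hypothesis bf : bounded_measurable f.

Let C : R := sval (cid bf.2).

Let fC z : (`|f z| <= C)%R. Proof. exact: (svalP (cid bf.2)). Qed.

Let C_ge0 (z : T1 * T2) : (0 <= C)%R. Proof. exact: le_trans (fC z). Qed.

Lemma bounded_measurable_section1 x : bounded_measurable (fun y => f (x, y)).
Proof.
split; last by exists C => y; exact: fC.
exact: (measurableT_comp bf.1 (measurable_pair1 x)).
Qed.

Lemma bounded_measurable_section2 y : bounded_measurable (fun x => f (x, y)).
Proof.
split; last by exists C => x; exact: fC.
exact: (measurableT_comp bf.1 (measurable_pair2 y)).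
Qed.

Let f_integrable : (mu \x nu).-integrable setT (EFin \o f).
Proof.
have mf : measurable_fun setT (EFin \o f) by apply/measurable_EFinP; exact: bf.1.
apply/(integrable12ltyP _ _ _).2 => //.
(* Tonelli's criterion: the iterated integral of the absolute value is at most [C] times the product
   of the two total masses. *)
apply: (@le_lt_trans _ _ (\int[mu]_x (C%:E * nu setT))).
  apply: ge0_le_integral => //.
  - by move=> x _; exact: integral_ge0.
  - apply: (measurable_fun_fubini_tonelli_F (abse \o (EFin \o f))) => //=.
    exact: measurableT_comp.
  - move=> x _; apply: integral_le_bound => //.
    + by apply/measurable_EFinP; case: (bounded_measurable_section1 x).
    + by rewrite lee_fin (C_ge0 (x, point)).
    + by apply: aeW => y _; rewrite lee_fin fC.
by rewrite integral_cst// ltey_eq !fin_numM//; exact: fin_num_measure.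
Qed.

Lemma bounded_measurable_Rintegral1 :
  bounded_measurable (fun x => \int[nu]_y f (x, y))%R.
Proof.
split.
  apply: (@measurableT_comp _ _ _ _ _ _ fine); first exact: fine_measurable.
  exact: measurable_fubini_F f_integrable.
exists (C * fine (nu setT))%R => x.
apply: (le_trans (le_normr_Rintegral _ _)) => //.
  exact/bounded_measurable_integrable/bounded_measurable_section1.
rewrite -Rintegral_cst//; apply: bounded_le_Rintegral => //.
- have [mfx _] := bounded_measurable_section1 x.
  split; first exact: measurableT_comp.
  by exists C => y; rewrite normr_id.
- exact: bounded_measurable_cst.
Qed.

Lemma bounded_Fubini :
  (\int[mu]_x \int[nu]_y f (x, y) = \int[nu]_y \int[mu]_x f (x, y))%R.
Proof.
rewrite /Rintegral; congr fine.
transitivity (\int[mu]_x \int[nu]_y (f (x, y))%:E).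
  apply: eq_integral => x _; rewrite fineK//; apply: integrable_fin_num => //.
  exact/bounded_measurable_integrable/bounded_measurable_section1.
rewrite (Fubini f_integrable); apply: eq_integral => y _; rewrite fineK//.
apply: integrable_fin_num => //.
exact/bounded_measurable_integrable/bounded_measurable_section2.
Qed.

End BoundedFubini.

Lemma bounded_measurable_Rintegral2 {d1 d2 : measure_display}
    {T1 : measurableType d1} {T2 : measurableType d2} {R : realType}
    (mu : {finite_measure set T1 -> \bar R}) (nu : {finite_measure set T2 -> \bar R})
    (f : T1 * T2 -> R) : bounded_measurable f ->
  bounded_measurable (fun y => \int[mu]_x f (x, y)).
Proof.
move=> [mf [C fC]].
have bf : bounded_measurable (fun z : T2 * T1 => f (z.2, z.1)).
  split; last by exists C => z; exact: fC.
  exact: (measurableT_comp mf (@measurable_swap _ _ T2 T1)).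
exact: (bounded_measurable_Rintegral1 nu mu bf).
Qed.

(** * The Green operator as a primitive followed by its adjoint *)

Section HalfLineOperator.
Context {R : realType}.
Implicit Types u g : measurableTypeR R -> R.

Let normr_bool (b : bool) : `|b%:R| <= 1 :> R.
Proof. by rewrite normr_nat; case: b. Qed.

Lemma bounded_measurable_le (x : R) :
  bounded_measurable (fun t : measurableTypeR R => (x <= t)%R%:R : R).
Proof.
split; last by exists 1 => t; exact: normr_bool.
rewrite [X in measurable_fun _ X](_ : _ = \1_(`[x, +oo[%classic : set R)).
  exact: measurable_indic.
by apply/funext => t; rewrite indicE mem_setE/= in_itv/= andbT.
Qed.

Lemma bounded_measurable_ge (t : R) :
  bounded_measurable (fun x : measurableTypeR R => (x <= t)%R%:R : R).
Proof.
split; last by exists 1 => x; exact: normr_bool.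
rewrite [X in measurable_fun _ X](_ : _ = \1_(`]-oo, t]%classic : set R)).
  exact: measurable_indic.
by apply/funext => x; rewrite indicE mem_setE/= in_itv.
Qed.

Lemma bounded_measurable_le_prod :
  bounded_measurable (fun z : measurableTypeR R * measurableTypeR R =>
    (z.1 <= z.2)%R%:R : R).
Proof.
split; last by exists 1 => z; exact: normr_bool.
rewrite [X in measurable_fun _ X](_ : _ = \1_[set z | z.1 <= z.2]).
  apply: measurable_indic; rewrite -[X in measurable X]setTI.
  exact: (@measurable_fun_le _ _ R).
apply/funext => z; rewrite indicE; congr ((nat_of_bool _)%:R).
by apply/idP/idP => [h|/set_mem//]; rewrite inE.
Qed.

Variables mu nu : {finite_measure set (measurableTypeR R) -> \bar R}.

(** The half line enters as a 0-1 factor, which is a bounded kernel on the product, so that Fubini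
    applies directly. *)
Definition lower_primitive u (t : measurableTypeR R) : R :=
  \int[mu]_x ((x <= t)%R%:R * u x).

Definition upper_primitive g (x : measurableTypeR R) : R :=
  \int[nu]_t ((x <= t)%R%:R * g t).

Lemma bounded_measurable_fst u : bounded_measurable u ->
  bounded_measurable (fun z : measurableTypeR R * measurableTypeR R => u z.1).
Proof.
move=> [mu_ [C uC]]; split; last by exists C => z.
exact: measurableT_comp mu_ measurable_fst.
Qed.

Lemma bounded_measurable_snd u : bounded_measurable u ->
  bounded_measurable (fun z : measurableTypeR R * measurableTypeR R => u z.2).
Proof.
move=> [mu_ [C uC]]; split; last by exists C => z.
exact: measurableT_comp mu_ measurable_snd.
Qed.

Lemma bounded_measurable_upper_primitive g : bounded_measurable g ->
  bounded_measurable (upper_primitive g).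
Proof.
move=> bg.
have bf : bounded_measurable
    (fun z : measurableTypeR R * measurableTypeR R => (z.1 <= z.2)%R%:R * g z.2).
  exact: bounded_measurableM bounded_measurable_le_prod (bounded_measurable_snd bg).
exact: (bounded_measurable_Rintegral1 mu nu bf).
Qed.

(** Both sides are the double integral of [u x * g t] over [x <= t]: the two primitives are adjoint
    to each other. *)
Lemma primitive_swap u g : bounded_measurable u -> bounded_measurable g ->
  \int[mu]_x (u x * upper_primitive g x) = \int[nu]_t (g t * lower_primitive u t).
Proof.
move=> bu bg.
have bf : bounded_measurable
    (fun z : measurableTypeR R * measurableTypeR R => (z.1 <= z.2)%R%:R * (u z.1 * g z.2)).
  apply: bounded_measurableM bounded_measurable_le_prod _; apply: bounded_measurableM.
    exact: bounded_measurable_fst.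
  exact: bounded_measurable_snd.
transitivity (\int[mu]_x \int[nu]_t ((x <= t)%R%:R * (u x * g t))).
  apply: eq_Rintegral => x _; rewrite -bounded_RintegralZ.
    by apply: eq_Rintegral => t _; rewrite mulrCA.
  exact: bounded_measurableM (bounded_measurable_le x) bg.
rewrite (bounded_Fubini mu nu bf); apply: eq_Rintegral => t _.
rewrite -bounded_RintegralZ.
  by apply: eq_Rintegral => x _; rewrite /=; ring.
exact: bounded_measurableM (bounded_measurable_ge t) bu.
Qed.

Lemma bounded_measurable_lower_primitive u : bounded_measurable u ->
  bounded_measurable (lower_primitive u).
Proof.
move=> bu.
have bf : bounded_measurable
    (fun z : measurableTypeR R * measurableTypeR R => (z.1 <= z.2)%R%:R * u z.1).
  exact: bounded_measurableM bounded_measurable_le_prod (bounded_measurable_fst bu).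
exact: (bounded_measurable_Rintegral2 mu nu bf).
Qed.

(* With nu the Lebesgue measure on [a, 1] containing the string, this is the
   integral operator with kernel int_a^1 1[s <= t] 1[x <= t] dt = min(1 - s, 1 - x),
   the Green function of - d^2/dx^2 with Neumann condition at a and Dirichlet
   condition at 1; the factorization makes its positivity visible. *)
Definition green_operator u := upper_primitive (lower_primitive u).

Lemma bounded_measurable_green u : bounded_measurable u ->
  bounded_measurable (green_operator u).
Proof.
by move=> bu; exact/bounded_measurable_upper_primitive/bounded_measurable_lower_primitive.
Qed.

(** The operator is the lower primitive followed by its adjoint, so its form is a [nu] inner product
    of lower primitives; symmetry and positivity are read off from this. *)
Lemma green_form u v : bounded_measurable u -> bounded_measurable v ->
  \int[mu]_x (v x * green_operator u x) =
  \int[nu]_t (lower_primitive u t * lower_primitive v t).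
Proof. by move=> bu bv; rewrite primitive_swap//; exact: bounded_measurable_lower_primitive. Qed.

Lemma green_form_sym u v : bounded_measurable u -> bounded_measurable v ->
  \int[mu]_x (v x * green_operator u x) = \int[mu]_x (u x * green_operator v x).
Proof.
move=> bu bv.
transitivity (\int[nu]_t (lower_primitive u t * lower_primitive v t)).
  exact: green_form.
transitivity (\int[nu]_t (lower_primitive v t * lower_primitive u t)).
  by apply: eq_Rintegral => t _; exact: mulrC.
exact/esym/green_form.
Qed.

Lemma green_form_ge0 u : bounded_measurable u ->
  0 <= \int[mu]_x (u x * green_operator u x).
Proof. by move=> bu; rewrite green_form//; apply: Rintegral_ge0 => t _; rewrite -expr2 sqr_ge0. Qed.

(** Cauchy-Schwarz at each [t] bounds the square of [lower_primitive u t] by the [mu] mass of the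
    half line up to [t] times the integral of [u ^+ 2]. Integrating in [t] and swapping gives the
    constant, which is the statical moment when [mu] is carried by [[a, 1]] and [nu] is the Lebesgue
    measure there. *)
Lemma green_form_le u : bounded_measurable u ->
  \int[mu]_x (u x * green_operator u x) <=
  \int[mu]_x upper_primitive (fun=> 1) x * \int[mu]_x (u x ^+ 2).
Proof.
move=> bu; rewrite green_form//.
have b1 : bounded_measurable (fun=> 1 : R) := bounded_measurable_cst 1.
have -> : \int[mu]_x upper_primitive (fun=> 1) x = \int[nu]_t lower_primitive (fun=> 1) t.
  transitivity (\int[mu]_x (1 * upper_primitive (fun=> 1) x)).
    by apply: eq_Rintegral => x _; rewrite mul1r.
  by rewrite primitive_swap//; apply: eq_Rintegral => t _; rewrite mul1r.
rewrite mulrC -bounded_RintegralZ; last exact: bounded_measurable_lower_primitive.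
apply: bounded_le_Rintegral.
- by apply: bounded_measurableM; exact: bounded_measurable_lower_primitive.
- exact/bounded_measurableZ/bounded_measurable_lower_primitive.
move=> t; rewrite -expr2 mulrC.
apply: le_trans (Rintegral_Cauchy_Schwarz _ (bounded_measurable_ge t) bu) _.
rewrite le_eqVlt; apply/orP; left; apply/eqP; congr (_ * _).
by apply: eq_Rintegral => x _; rewrite mulr1 expr2 -natrM mulnb andbb.
Qed.

End HalfLineOperator.

(** * Pairing the equation with its solution *)

(** Since [g] vanishes off [D], the formula for [f] on [D] determines the integral. Letting [f] and
    [g] range over the real and imaginary parts of a solution yields four real pairings. *)
Lemma Rintegral_pairing {d : measure_display} {T : measurableType d} {R : realType}
    (mu : {finite_measure set T -> \bar R}) (D : set T) (g f k l : T -> R) (c1 c2 c3 : R) :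
    bounded_measurable g -> bounded_measurable k -> bounded_measurable l ->
    (forall x, D x -> f x = c1 + c2 * k x + c3 * l x) ->
    (forall x, ~ D x -> g x = 0) ->
  \int[mu]_x (g x * f x) = c1 * \int[mu]_x g x + c2 * \int[mu]_x (g x * k x)
    + c3 * \int[mu]_x (g x * l x).
Proof.
move=> bg bk bl fD gD.
have bgk := bounded_measurableM bg bk; have bgl := bounded_measurableM bg bl.
rewrite -(bounded_RintegralZ mu c1 bg) -(bounded_RintegralZ mu c2 bgk).
rewrite -(bounded_RintegralZ mu c3 bgl).
have b1 := bounded_measurableZ c1 bg; have b2 := bounded_measurableZ c2 bgk.
have b3 := bounded_measurableZ c3 bgl.
rewrite -(bounded_RintegralD mu b1 b2) -(bounded_RintegralD mu (bounded_measurableD b1 b2) b3).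
apply: eq_Rintegral => x _; have [xD|xD] := pselect (D x).
  by rewrite fD//; ring.
by rewrite gD//; ring.
Qed.

(* The hypothesis on D is y = - i kappa Y + kappa^2 k(y) for y = u + i v, in real
   and imaginary parts; the conclusion is 1 = - i kappa b + kappa^2 a. *)
Lemma quasi_eigenvalue_moments {d : measure_display} {T : measurableType d}
    {R : realType} (mu : {finite_measure set T -> \bar R}) (D : set T)
    (u v ku kv : T -> R) (alpha beta W : R) :
    let Yu := \int[mu]_x u x in let Yv := \int[mu]_x v x in
    bounded_measurable u -> bounded_measurable v ->
    bounded_measurable ku -> bounded_measurable kv ->
    \int[mu]_x (v x * ku x) = \int[mu]_x (u x * kv x) ->
    0 <= \int[mu]_x (u x * ku x) <= W * \int[mu]_x (u x ^+ 2) ->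
    0 <= \int[mu]_x (v x * kv x) <= W * \int[mu]_x (v x ^+ 2) ->
    (forall x, D x ->
      u x = beta * Yu + alpha * Yv
        + (alpha ^+ 2 - beta ^+ 2) * ku x - 2 * alpha * beta * kv x /\
      v x = beta * Yv - alpha * Yu
        + (alpha ^+ 2 - beta ^+ 2) * kv x + 2 * alpha * beta * ku x) ->
    (forall x, ~ D x -> u x = 0 /\ v x = 0) ->
    0 < \int[mu]_x (u x ^+ 2) + \int[mu]_x (v x ^+ 2) ->
  exists a b, [/\ 0 <= a <= W,
    0 <= b <= fine (mu setT),
    1 = beta * b + (alpha ^+ 2 - beta ^+ 2) * a &
    alpha * b = 2 * alpha * beta * a].
Proof.
move=> Yu Yv bu bv bku bkv Avu /andP[u_ge0 u_le] /andP[v_ge0 v_le] onD offD.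
set Nu := \int[mu]_x (u x ^+ 2) in u_le *.
set Nv := \int[mu]_x (v x ^+ 2) in v_le * => N_gt0.
pose Auu := \int[mu]_x (u x * ku x).
pose Avv := \int[mu]_x (v x * kv x).
pose Auv := \int[mu]_x (u x * kv x).
pose p := alpha ^+ 2 - beta ^+ 2; pose q := 2 * alpha * beta.
have uD x : ~ D x -> u x = 0 by move=> /offD[].
have vD x : ~ D x -> v x = 0 by move=> /offD[].
have fu x : D x -> u x = (beta * Yu + alpha * Yv) + p * ku x + (- q) * kv x.
  by move=> /onD[{1}-> _]; rewrite /p /q; ring.
have fv x : D x -> v x = (beta * Yv - alpha * Yu) + q * ku x + p * kv x.
  by move=> /onD[_ {1}->]; rewrite /p /q; ring.
have := Rintegral_pairing mu bu bku bkv fu uD; rewrite -/Yu -/Auu -/Auv.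
have := Rintegral_pairing mu bv bku bkv fv vD; rewrite -/Yv -/Avv Avu.
have := Rintegral_pairing mu bv bku bkv fu vD; rewrite -/Yv -/Avv Avu.
have := Rintegral_pairing mu bu bku bkv fv uD; rewrite -/Yu -/Auu -/Auv.
have -> : \int[mu]_x (u x * u x) = Nu by apply: eq_Rintegral => x _; rewrite expr2.
have -> : \int[mu]_x (v x * v x) = Nv by apply: eq_Rintegral => x _; rewrite expr2.
have -> : \int[mu]_x (v x * u x) = \int[mu]_x (u x * v x).
  by apply: eq_Rintegral => x _; rewrite mulrC.
move=> Euv Evu Evv Euu.
(* Real part of the pairing with the conjugate of [y]: the terms in [Yu * Yv] and, by symmetry of
   the form, those in [Auv] cancel. *)
have EN : Nu + Nv = beta * (Yu ^+ 2 + Yv ^+ 2) + p * (Auu + Avv) by rewrite Evv Euu; ring.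
(* Imaginary part: the two expressions for the integral of [u * v] are subtracted, and again the
   mixed terms cancel. *)
have E0 : alpha * (Yu ^+ 2 + Yv ^+ 2) = q * (Auu + Avv).
  apply/eqP; rewrite -subr_eq0; apply/eqP.
  move: Euv; rewrite Evu => /eqP; rewrite -subr_eq0 => /eqP E.
  by rewrite -[RHS]E; ring.
have Y_le g : bounded_measurable g ->
    (\int[mu]_x g x) ^+ 2 <= fine (mu setT) * \int[mu]_x (g x ^+ 2).
  move=> bg.
  have b1 : bounded_measurable ((fun=> 1) : T -> R) := bounded_measurable_cst 1.
  have -> : \int[mu]_x g x = \int[mu]_x (1 * g x).
    by apply: eq_Rintegral => x _; rewrite mul1r.
  have -> : fine (mu setT) = \int[mu]_x (1 ^+ 2).
    by rewrite Rintegral_cst// expr1n mul1r.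
  exact: Rintegral_Cauchy_Schwarz.
have N_neq0 : Nu + Nv != 0 by rewrite gt_eqF.
(* The Rayleigh quotient of the Green operator at [y], and the squared modulus of the integral of
   [y] over its squared norm. *)
exists ((Auu + Avv) / (Nu + Nv)), ((Yu ^+ 2 + Yv ^+ 2) / (Nu + Nv)); split.
- rewrite ler_pdivlMr// ler_pdivrMr// mul0r addr_ge0 //=.
  by rewrite mulrDr lerD.
- rewrite ler_pdivlMr// ler_pdivrMr// mul0r addr_ge0 ?sqr_ge0//=.
  by rewrite mulrDr lerD ?Y_le.
- by rewrite !mulrA -mulrDl -EN divff.
- by rewrite !mulrA E0.
Qed.

(** * Cutting a regular string down to a compact interval *)

Section RestrictedString.
Context {R : realType}.
Variable M : {measure set (measurableTypeR R) -> \bar R}.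

(** Every point outside the support has a null neighbourhood, hence lies in a null interval with
    rational endpoints; there are countably many of these, so their union is null. *)
Lemma regular_string_null_left : has_lbound (supp M) ->
  exists2 a : R, a <= 1 & M `]-oo, a[%classic = 0%E.
Proof.
(* An arbitrary lower bound of the support may exceed 1, hence the minimum. *)
move=> [a0 lb_a0]; exists (Num.min a0 1); first by rewrite ge_min lexx orbT.
pose J (pq : rat * rat) : set R := `]ratr pq.1, ratr pq.2[%classic.
(* Enumerates the rational intervals by their codes, with the empty set in place of those of
   positive mass. *)
pose F n : set (measurableTypeR R) :=
  if unpickle n is Some pq then if M (J pq) == 0%E then J pq else set0 else set0.
have negF n : M.-negligible (F n).
  rewrite /F; case: unpickle => [pq|]; last exact: negligible_set0.
  case: eqP => [MI|_]; last exact: negligible_set0.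
  by exists (J pq); split => //; exact: measurable_itv.
have [B [mB MB FB]] := negligible_bigcup negF.
apply/eqP; rewrite -measure_le0 -MB le_measure ?inE//.
move=> x /=; rewrite in_itv/= lt_min => /andP[xa0 _]; apply: FB.
have /existsNP[U /not_implyP[oU /not_implyP[Ux MU]]] : ~ supp M x.
  by move=> /lb_a0; rewrite leNgt xa0.
have {}MU : M U = 0%E.
  by apply/eqP; rewrite eq_le measure_ge0 andbT leNgt; apply/negP.
have /nbhs_ballP[e /= e0 xeU] : nbhs x U by exact: open_nbhs_nbhs.
have [p] := @rat_in_itvoo R (x - e) x ltac:(by rewrite ltrBlDr ltrDl).
rewrite in_itv/= => /andP[xep px].
have [q] := @rat_in_itvoo R x (x + e) ltac:(by rewrite ltrDl).
rewrite in_itv/= => /andP[xq qxe].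
have IU : J (p, q) `<=` U.
  move=> t; rewrite /J/= in_itv/= => /andP[pt tq]; apply: xeU.
  by rewrite /ball/= ltr_distlC; apply/andP; split; lra.
have MI : M (J (p, q)) == 0%E.
  rewrite -measure_le0 -MU; apply: le_measure; rewrite ?inE//; first exact: measurable_itv.
  exact: open_measurable.
exists (pickle (p, q)); first by [].
by rewrite /F pickleK MI /J/= in_itv/= px xq.
Qed.

Variable a : R.
Hypothesis null_left : M `]-oo, a[%classic = 0%E.
Let E : set (measurableTypeR R) := `[a, 1%R]%classic.
Hypothesis mE : measurable E.
Hypothesis ME_fin : (M E < +oo)%E.
Let mu := mfrestr mE ME_fin.

(** Carries integrals over an infinite half line to the finite measure [mu] on [[a, 1]]: what lies
    to the left of [a] is null, and [f0] vanishes outside [E]. *)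
Lemma Rintegral_string (x : R) (f f0 : R -> R) : x <= 1 ->
    measurable_fun (`]-oo, x]%classic : set (measurableTypeR R)) f ->
    measurable_fun (setT : set (measurableTypeR R)) f0 ->
    (forall s, a <= s <= x -> f s = f0 s) ->
    (forall s, ~ E s -> f0 s = 0) ->
  \int[M]_(s in `]-oo, x]%classic) f s = \int[mu]_s ((s <= x)%R%:R * f0 s).
Proof.
move=> x1 mf mf0 ff0 f00; pose D : set (measurableTypeR R) := `]-oo, x]%classic.
have mD : measurable D by exact: measurable_itv.
rewrite /Rintegral; congr fine.
transitivity (\int[M]_(s in D) (f0 s)%:E)%E.
  apply: ae_eq_integral => //; [exact/measurable_EFinP|apply/measurable_EFinP|].
    exact: measurable_funTS.
  exists (`]-oo, a[%classic); split => //.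
  move=> s /= ns; rewrite in_itv/= ltNge; apply/negP => as_.
  by apply: ns => /=; rewrite /D/= in_itv/= => sx; rewrite ff0// as_.
have -> : (\int[M]_(s in D) (f0 s)%:E = \int[M]_(s in D `&` E) (f0 s)%:E)%E.
  rewrite [RHS]integral_mkcondr; apply: eq_integral => s _.
  by rewrite patchE; case: ifPn => //; rewrite notin_setE => /f00 ->.
have -> : (\int[M]_(s in D `&` E) (f0 s)%:E = \int[mu]_(s in D `&` E) (f0 s)%:E)%E.
  apply: eq_measure_integral => /= A mA ADE.
  by rewrite /mu /mfrestr /mrestr setIidl// => s /ADE[].
rewrite [LHS]integral_mkcond; apply: eq_integral => s _.
rewrite patchE; case: ifPn => [/set_mem[]|].
  by rewrite /D/= in_itv/= => -> _; rewrite mul1r.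
rewrite notin_setE => nDE; congr EFin; have [sx|sx] := leP s x; last by rewrite mul0r.
by rewrite f00 ?mulr0// => Es; apply: nDE; split => //; rewrite /D/= in_itv.
Qed.

Lemma integrable_string (f : R -> R) :
  M.-integrable `]-oo, 1%R]%classic (EFin \o f) ->
  mu.-integrable setT (EFin \o (f \_ E)).
Proof.
move=> Mf; have /integrableP[mf foo] : M.-integrable E (EFin \o f).
  apply: integrableS Mf => //.
  by move=> s /=; rewrite !in_itv/= => /andP[].
rewrite -restrict_EFin; apply/integrable_restrict => //; rewrite setTI.
apply/integrableP; split => //; apply: le_lt_trans foo.
rewrite le_eqVlt; apply/orP; left; apply/eqP.
apply: eq_measure_integral => /= A mA AE.
by rewrite /mu /mfrestr /mrestr setIidl.
Qed.

End RestrictedString.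

(** * The kernel for the Lebesgue measure on the interval *)

Section GreenKernel.
Context {R : realType}.
Variable a : R.
Let E : set (measurableTypeR R) := `[a, 1%R]%classic.
Hypothesis mE : measurable E.
Hypothesis LE_fin : (@lebesgue_measure R E < +oo)%E.
Let nu := mfrestr mE LE_fin.

Lemma upper_primitive_step (s x : R) : E s -> E x ->
  upper_primitive nu (fun t => (x <= t)%R%:R) s = 1 - Num.max s x.
Proof.
rewrite /E/= !in_itv/= => /andP[as_ s1] /andP[ax x1].
have max1 : Num.max s x <= 1 by rewrite ge_max s1.
rewrite /upper_primitive.
have -> : \int[nu]_t ((s <= t)%R%:R * (x <= t)%R%:R) =
    \int[nu]_(t in `[Num.max s x, +oo[%classic) 1.
  rewrite [RHS]Rintegral_mkcond; apply: eq_Rintegral => t _.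
  by rewrite patchE mem_setE in_itv/= andbT ge_max; do 2 case: (_ <= _); rewrite ?mul1r ?mul0r.
have nuE : nu `[Num.max s x, +oo[%classic = lebesgue_measure `[Num.max s x, 1%R]%classic.
  rewrite /nu /mfrestr /mrestr; congr (lebesgue_measure _).
  apply/seteqP; split => t /=; rewrite /E/= !in_itv/= andbT.
    by move=> [-> /andP[_ ->]].
  by move=> /andP[mt t1]; split => //; rewrite t1 (le_trans as_)// (le_trans _ mt)// le_max lexx.
rewrite Rintegral_cst// mul1r.
transitivity (fine (@lebesgue_measure R `[Num.max s x, 1%R]%classic)).
  by congr fine; exact: nuE.
rewrite lebesgue_measure_itv/= lte_fin.
(* The length formula treats an interval without interior separately, with value 0; here that
   happens only when the maximum is 1. *)
case: ltP => //= max1'.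
have -> : Num.max s x = 1 by apply/eqP; rewrite eq_le max1 max1'.
by rewrite subrr.
Qed.

Variable mu : {finite_measure set (measurableTypeR R) -> \bar R}.

Lemma bounded_measurable_subr (y : R) :
  bounded_measurable ((fun s : measurableTypeR R => y - s) \_ E).
Proof.
apply: bounded_measurable_restrict => //.
  by apply: measurable_funB => //; exact: measurable_cst.
exists (`|y| + (`|a| + 1)) => s; rewrite /E/= in_itv/= => /andP[as_ s1].
rewrite (le_trans (ler_normB _ _))// lerD2l ler_norml; apply/andP; split.
  rewrite (le_trans _ as_)// lerNl (le_trans (ler_norm _))//.
  by rewrite normrN lerDl.
by rewrite (le_trans s1)// lerDr.
Qed.

(** The kernel [1 - Num.max s x] equals [1 - s] minus the positive part of [x - s]. This links the
    Green operator to the Volterra integrals of the string equation, taken at 1 and at [x]. *)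
Lemma green_operatorE (u : measurableTypeR R -> R) (x : R) :
  bounded_measurable u -> (forall s, ~ E s -> u s = 0) -> E x ->
  green_operator mu nu u x =
    \int[mu]_s ((s <= 1)%R%:R * ((1 - s) * u s))
    - \int[mu]_s ((s <= x)%R%:R * ((x - s) * u s)).
Proof.
move=> bu u0 Ex; move: (Ex); rewrite /E/= in_itv/= => /andP[ax x1].
transitivity (\int[mu]_s (u s * upper_primitive nu (fun t => (x <= t)%R%:R) s)).
  exact: esym (primitive_swap mu nu bu (bounded_measurable_le x)).
have bw y : y <= 1 ->
    bounded_measurable (fun s : measurableTypeR R => (s <= y)%R%:R * ((y - s) * u s)).
  move=> y1; apply: bounded_measurableM (bounded_measurable_ge y) _.
  (* The weight [y - s] is unbounded on the line; since [u] vanishes off [E], its restriction to [E]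
     can replace it. *)
  have bE := bounded_measurable_subr y.
  rewrite (_ : (fun s => _) = (fun s => ((fun s : measurableTypeR R => y - s) \_ E) s * u s)).
    exact: bounded_measurableM.
  apply/funext => s; rewrite patchE; case: ifPn => //; rewrite notin_setE => /u0 ->.
  by rewrite !mulr0.
have b1 := bw _ (lexx 1); have bx := bw _ x1.
rewrite -RintegralB//; [|exact: bounded_measurable_integrable..].
apply: eq_Rintegral => s _; have [Es|/u0 ->] := pselect (E s); last first.
  by rewrite !mulr0 mul0r subr0.
rewrite upper_primitive_step//; move: Es; rewrite /E/= in_itv/= => /andP[_ ->].
by rewrite mul1r; case: (leP s x) => _ /=; ring.
Qed.

(** Turns the constant of the Green form bound into a statical moment. *)
Lemma upper_primitive1 (x : R) : E x -> upper_primitive nu (fun=> 1) x = 1 - x.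
Proof.
move=> Ex; rewrite -[in RHS](maxxx x) -(upper_primitive_step Ex Ex).
apply: eq_Rintegral => t _; by case: (_ <= _); rewrite ?mul1r ?mul0r.
Qed.

End GreenKernel.

(** * Necessary conditions on a quasi-eigenvalue *)

(** A solution is only assumed integrable, and its nonzero value may lie off the support. The
    pairing argument applies once the solution is shown to be bounded on [[a, 1]] and of positive
    norm. *)
Lemma admissible_moments (R : realType) (m S : R)
    (M : {measure set (measurableTypeR R) -> \bar R}) (kappa : R[i]) :
    admissible m S M -> quasi_eigenvalues M kappa ->
  let alpha := complex.Re kappa in let beta := complex.Im kappa in
  exists a b, [/\ 0 <= a <= S, 0 <= b <= m,
    1 = beta * b + (alpha ^+ 2 - beta ^+ 2) * a &
    alpha * b = 2 * alpha * beta * a].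
Proof.
move=> [[[_ Mfin] lb] /andP[_ tm_le] /andP[_ sm_le]].
move=> [k0 [y [[[yr yi] [c yE]] y1 [x0 x01 yx0]]]] alpha beta.
have [a a1 Ma0] := regular_string_null_left lb.
pose E : set (measurableTypeR R) := `[a, 1%R]%classic.
have mE : measurable E by exact: measurable_itv.
pose mu := mfrestr mE (Mfin a).
have LE_fin : (@lebesgue_measure R E < +oo)%E.
  by rewrite lebesgue_measure_itv/=; case: ifPn => // _; rewrite -EFinB ltry.
pose nu := mfrestr mE LE_fin.
pose U x := complex.Re (y x); pose V x := complex.Im (y x).
pose J (f : R -> R) x := \int[mu]_s ((s <= x)%R%:R * ((x - s) * f s)).
have patch0 (f : R -> R) s : ~ E s -> (f \_ E) s = 0.
  by move=> Es; rewrite patchE memNset.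
have patchI (f : R -> R) s : a <= s <= 1 -> f s = (f \_ E) s.
  by move=> Es; rewrite patchE mem_set// /E/= in_itv.
have mD x : x <= 1 -> (`]-oo, x]%classic : set (measurableTypeR R)) `<=` `]-oo, 1]%classic.
  by move=> x1 s /=; rewrite !in_itv/= => /le_trans; apply.
have intE (f : R -> R) : M.-integrable `]-oo, 1]%classic (EFin \o f) ->
    [/\ measurable_fun (`]-oo, 1]%classic : set (measurableTypeR R)) f,
     measurable_fun (setT : set (measurableTypeR R)) (f \_ E) &
     mu.-integrable setT (EFin \o (f \_ E))].
  move=> Mf; have muf := integrable_string mE (Mfin a) Mf.
  split => //; first by move/integrableP : Mf => [/measurable_EFinP].
  by move/integrableP : muf => [/measurable_EFinP].
have JE (f : R -> R) x : M.-integrable `]-oo, 1]%classic (EFin \o f) -> x <= 1 ->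
    \int[M]_(s in `]-oo, x]%classic) ((x - s) * f s) = J (f \_ E) x.
  move=> Mf x1; have [mf mfE _] := intE _ Mf.
  apply: (Rintegral_string Ma0 mE (Mfin a) x1).
  - apply: measurable_funM; first by apply: measurable_funB => //; exact: measurable_cst.
    by apply: measurable_funS mf => //; exact: mD.
  - by apply: measurable_funM => //; apply: measurable_funB => //; exact: measurable_cst.
  - by move=> s /andP[as_ sx]; rewrite -patchI// as_ (le_trans sx).
  - by move=> s /patch0 ->; rewrite mulr0.
have YE (f : R -> R) : M.-integrable `]-oo, 1]%classic (EFin \o f) ->
    \int[M]_(s in `]-oo, 1]%classic) f s = \int[mu]_s (f \_ E) s.
  move=> Mf; have [mf mfE _] := intE _ Mf.
  rewrite (Rintegral_string Ma0 mE (Mfin a) (lexx 1) mf mfE) //.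
  - apply: eq_Rintegral => s _; have [Es|/patch0 ->] := pselect (E s); last by rewrite mulr0.
    by move: Es; rewrite /E/= in_itv/= => /andP[_ ->]; rewrite mul1r.
  - exact: patchI.
  - exact: patch0.
pose u : measurableTypeR R -> R := U \_ E; pose v : measurableTypeR R -> R := V \_ E.
pose Yu := \int[mu]_s u s; pose Yv := \int[mu]_s v s.
have eqJ x : x <= 1 ->
    U x = complex.Re c - ((alpha ^+ 2 - beta ^+ 2) * J u x - 2 * alpha * beta * J v x) /\
    V x = complex.Im c - ((alpha ^+ 2 - beta ^+ 2) * J v x + 2 * alpha * beta * J u x).
  move=> x1; have yxE := yE x x1.
  have cE : cintegral M `]-oo, x]%classic (fun s => (x - s)%:C * y s) = J u x +i* J v x.
    rewrite /cintegral -(JE U x yr x1) -(JE V x yi x1); congr (_ +i* _);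
      apply: eq_Rintegral => s _; rewrite /U /V; case: (y s) => p q /=; ring.
  rewrite /U /V yxE cE /alpha /beta; case: (kappa) c {yE yxE} => p q [c1 c2] /=.
  by rewrite expr2 /=; split; ring.
(* The condition at the right end in the form [y 1 = - i * kappa * Y], split into real and imaginary
   parts. *)
have eq1 : U 1 = beta * Yu + alpha * Yv /\ V 1 = beta * Yv - alpha * Yu.
  rewrite /U /V y1 /right_slope /cintegral (YE _ yr) (YE _ yi) -/u -/v -/Yu -/Yv.
  have -> : 'i / kappa * (- kappa ^+ 2 * (Yu +i* Yv)) = - 'i * kappa * (Yu +i* Yv) by field.
  by rewrite /alpha /beta; case: (kappa) => p q /=; split; ring.
(* On [E] the weight satisfies [0 <= x - s <= 1 - a] wherever the 0-1 factor is nonzero, so the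
   Volterra term is bounded by an [L^1] norm and the equation itself makes [y] bounded. *)
have J_bound (f : R -> R) x : M.-integrable `]-oo, 1]%classic (EFin \o f) -> x <= 1 ->
    `|J (f \_ E) x| <= (1 - a) * \int[mu]_s `|(f \_ E) s|.
  move=> Mf x1; have [_ mfE intf] := intE _ Mf.
  have int_normf : mu.-integrable setT (EFin \o (fun s => (1 - a) * `|(f \_ E) s|)).
    have -> : EFin \o (fun s => (1 - a) * `|(f \_ E) s|) =
        (fun s => (1 - a)%:E * (EFin \o (Num.norm \o (f \_ E))) s)%E.
      by apply/funext => s; rewrite /= EFinM.
    by apply: integrableZl => //; exact: integrable_norm.
  have le_f s : `|(s <= x)%R%:R * ((x - s) * (f \_ E) s)| <= (1 - a) * `|(f \_ E) s|.
    have [Es|/patch0 ->] := pselect (E s); last by rewrite !mulr0 normr0 mulr0.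
    move: Es; rewrite /E/= in_itv/= => /andP[as_ _].
    have [sx|sx] := leP s x; last by rewrite mul0r normr0 mulr_ge0// subr_ge0.
    by rewrite mul1r normrM ler_wpM2r// ger0_norm ?subr_ge0// lerB.
  have mJ : measurable_fun (setT : set (measurableTypeR R))
      (fun s => (s <= x)%R%:R * ((x - s) * (f \_ E) s)).
    apply: measurable_funM; first exact: (bounded_measurable_ge x).1.
    by apply: measurable_funM => //; apply: measurable_funB => //; exact: measurable_cst.
  have intJ : mu.-integrable setT (EFin \o (fun s => (s <= x)%R%:R * ((x - s) * (f \_ E) s))).
    apply: le_integrable int_normf => //; first exact/measurable_EFinP.
    by move=> s _; rewrite /= lee_fin (le_trans (le_f s))// ler_norm.
  apply: (le_trans (le_normr_Rintegral _ intJ)) => //.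
  rewrite -RintegralZl//; last exact: integrable_norm.
  apply: le_Rintegral => //; exact: integrable_norm intJ.
have bu : bounded_measurable u.
  have [mU _ _] := intE _ yr.
  apply: bounded_measurable_restrict => //.
    apply: measurable_funS mU => // s.
    by rewrite /E/= !in_itv/= => /andP[].
  (* The bound stays open here; the triangle inequality applied to [eqJ] fills it in. *)
  eexists => x; rewrite /E/= in_itv/= => /andP[_ x1].
  rewrite (eqJ x x1).1; apply: le_trans (ler_normB _ _) _; apply: lerD (lexx _) _.
  apply: le_trans (ler_normB _ _) _; rewrite !normrM.
  by apply: lerD; apply: ler_wpM2l => //; exact: J_bound.
have bv : bounded_measurable v.
  have [mV _ _] := intE _ yi.
  apply: bounded_measurable_restrict => //.
    apply: measurable_funS mV => // s.
    by rewrite /E/= !in_itv/= => /andP[].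
  eexists => x; rewrite /E/= in_itv/= => /andP[_ x1].
  rewrite (eqJ x x1).2; apply: le_trans (ler_normB _ _) _; apply: lerD (lexx _) _.
  apply: le_trans (ler_normD _ _) _; rewrite !normrM.
  by apply: lerD; apply: ler_wpM2l => //; exact: J_bound.
have J0 (f : measurableTypeR R -> R) x : bounded_measurable f ->
    (forall s, ~ E s -> f s = 0) -> \int[mu]_s (f s ^+ 2) = 0 -> J f x = 0.
  move=> bf f0 fN.
  have bh : bounded_measurable (fun s : measurableTypeR R =>
      (s <= x)%R%:R * ((fun s : measurableTypeR R => x - s) \_ E) s).
    exact: bounded_measurableM (bounded_measurable_ge x) (bounded_measurable_subr mE x).
  have -> : J f x = \int[mu]_s (((s <= x)%R%:R * ((fun s => x - s) \_ E) s) * f s).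
    apply: eq_Rintegral => s _; rewrite patchE; case: ifPn => [_|]; first by rewrite mulrA.
    by rewrite notin_setE => /f0 ->; rewrite !mulr0.
  have := Rintegral_Cauchy_Schwarz mu bh bf; rewrite fN mulr0.
  by rewrite real_exprn_even_le0 ?num_real//= => /eqP.
have Y0 (f : measurableTypeR R -> R) : bounded_measurable f ->
    \int[mu]_s (f s ^+ 2) = 0 -> \int[mu]_s f s = 0.
  move=> bf fN; have b1 := @bounded_measurable_cst _ (measurableTypeR R) R 1.
  have -> : \int[mu]_s f s = \int[mu]_s (1 * f s).
    by apply: eq_Rintegral => s _; rewrite mul1r.
  have := Rintegral_Cauchy_Schwarz mu b1 bf; rewrite fN mulr0.
  by rewrite real_exprn_even_le0 ?num_real//= => /eqP.
have u0 s : ~ E s -> u s = 0 by exact: patch0.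
have v0 s : ~ E s -> v s = 0 by exact: patch0.
have sq_ge0 (f : measurableTypeR R -> R) : 0 <= \int[mu]_s (f s ^+ 2).
  by apply: Rintegral_ge0 => s _; exact: sqr_ge0.
(* With zero norm, Cauchy-Schwarz kills the Volterra terms and the integral of [y]; the condition at
   1 then gives [c = 0], so [y] vanishes at every point up to 1, in particular at [x0]. *)
have N_gt0 : 0 < \int[mu]_s (u s ^+ 2) + \int[mu]_s (v s ^+ 2).
  rewrite lt_neqAle addr_ge0// andbT eq_sym paddr_eq0//; apply/negP => /andP[/eqP Nu /eqP Nv].
  have Ju x : J u x = 0 by exact: J0.
  have Jv x : J v x = 0 by exact: J0.
  have Yu0 : Yu = 0 by exact: Y0.
  have Yv0 : Yv = 0 by exact: Y0.
  have [U1 V1] := eq1; have [] := eqJ 1 (lexx 1).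
  rewrite Ju Jv U1 V1 Yu0 Yv0 !mulr0 !(addr0, subr0, oppr0) => c1 c2.
  have [] := eqJ x0 x01; rewrite Ju Jv -c1 -c2 !mulr0 !(addr0, subr0, oppr0).
  rewrite /U /V; move: yx0; case: (y x0) => p q /= /eqP yx0 p0 q0.
  by apply: yx0; rewrite p0 q0.
have W_le : \int[mu]_x upper_primitive nu (fun=> 1) x <= S.
  have bW : bounded_measurable (upper_primitive nu (fun=> 1)).
    exact: bounded_measurable_upper_primitive mu nu _ (bounded_measurable_cst 1).
  have intW := bounded_measurable_integrable mu bW.
  rewrite -lee_fin /Rintegral fineK; last exact: integrable_fin_num intW.
  apply: le_trans sm_le.
  (* The formula [1 - x] for the upper primitive is available only on [E], so the integral is first
     cut down to [E], whose complement is [mu]-null. *)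
  rewrite (negligible_integral (measurableC mE) measurableT intW); last first.
    by change (M (~` E `&` E) = 0%E); rewrite setICl measure0.
  rewrite setTD setCK.
  have -> : (\int[mu]_(x in E) (upper_primitive nu (fun=> 1) x)%:E =
      \int[M]_(x in E) (1 - x)%:E)%E.
    transitivity (\int[mu]_(x in E) (1 - x)%:E)%E.
      by apply: eq_integral => s /set_mem Es; rewrite (upper_primitive1 mE LE_fin).
    apply: eq_measure_integral => /= A mA AE.
    by rewrite /mu /mfrestr /mrestr setIidl.
  apply: ge0_subset_integral => //.
  - by apply/measurable_EFinP; apply: measurable_funB => //; exact: measurable_cst.
  - by move=> s /=; rewrite in_itv/= lee_fin subr_ge0.
  - by move=> s; rewrite /E/= !in_itv/= => /andP[].
have mu_le : fine (mu setT) <= m.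
  rewrite -lee_fin fineK; last exact: fin_num_measure.
  apply: le_trans tm_le; rewrite /mu /mfrestr /mrestr setTI le_measure ?inE//.
  by move=> s; rewrite /E/= !in_itv/= => /andP[].
(* Comparing the equations at [x] and at 1 eliminates [c], and the difference of Volterra terms is
   the Green operator. *)
have onE x : E x ->
    u x = beta * Yu + alpha * Yv + (alpha ^+ 2 - beta ^+ 2) * green_operator mu nu u x
      - 2 * alpha * beta * green_operator mu nu v x /\
    v x = beta * Yv - alpha * Yu + (alpha ^+ 2 - beta ^+ 2) * green_operator mu nu v x
      + 2 * alpha * beta * green_operator mu nu u x.
  move=> Ex; rewrite (green_operatorE mE LE_fin mu bu u0 Ex).
  rewrite (green_operatorE mE LE_fin mu bv v0 Ex).
  rewrite -/(J u 1) -/(J u x) -/(J v 1) -/(J v x).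
  have ax1 : a <= x <= 1 by move: Ex; rewrite /E/= in_itv.
  have x1 : x <= 1 by case/andP: ax1.
  have -> : u x = U x by exact: esym (patchI _ _ ax1).
  have -> : v x = V x by exact: esym (patchI _ _ ax1).
  have [Ux Vx] := eqJ x x1; have [U1 V1] := eqJ 1 (lexx 1).
  have [U1' V1'] := eq1; rewrite -U1' -V1' Ux Vx U1 V1.
  by split; ring.
have offE x : ~ E x -> u x = 0 /\ v x = 0 by move=> Ex; rewrite u0// v0.
have [p [q [/andP[p0 pW] /andP[q0 qm] e1 e2]]] := quasi_eigenvalue_moments bu bv
  (bounded_measurable_green mu nu bu) (bounded_measurable_green mu nu bv)
  (green_form_sym mu nu bu bv)
  (introT andP (conj (green_form_ge0 mu nu bu) (green_form_le mu nu bu)))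
  (introT andP (conj (green_form_ge0 mu nu bv) (green_form_le mu nu bv)))
  onE offE N_gt0.
exists p, q; split => //; first by rewrite p0 (le_trans pW).
by rewrite q0 (le_trans qm).
Qed.

(** * Strings made of a single point mass *)

Section PointMass.
Context {R : realType}.
Variables (c : {nonneg R}) (b : R).

Definition point_mass : {measure set (measurableTypeR R) -> \bar R} :=
  mscale c (@dirac _ (measurableTypeR R) b R).

Lemma point_massE (D : set (measurableTypeR R)) :
  point_mass D = (c%:num * (b \in D)%:R)%:E.
Proof. by rewrite /point_mass /= /mscale /= diracE EFinM. Qed.

Lemma integral_point_mass (D : set (measurableTypeR R)) (f : R -> R) :
  measurable D -> measurable_fun D f ->
  (\int[point_mass]_(x in D) (f x)%:E = (c%:num * (b \in D)%:R * f b)%:E)%E.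
Proof.
move=> mD mf; rewrite [RHS]EFinM -point_massE muleC -integral_cst//.
apply: ae_eq_integral => //; first exact/measurable_EFinP.
exists (~` [set b]); split.
- exact: measurableC.
- by rewrite point_massE memNset/= ?mulr0//; apply.
- by move=> x /= nx xb; apply: nx => _; rewrite xb.
Qed.

Lemma integrable_point_mass (D : set (measurableTypeR R)) (f : R -> R) :
  measurable D -> measurable_fun D f -> point_mass.-integrable D (EFin \o f).
Proof.
move=> mD mf; apply/integrableP; split; first exact/measurable_EFinP.
by rewrite (@integral_point_mass _ (fun x => `|f x|)) ?ltry//; exact: measurableT_comp.
Qed.

Hypothesis b_le1 : b <= 1.

Lemma point_mass_admissible (m S : R) : 0 < c%:num <= m -> c%:num * (1 - b) <= S ->
  admissible m S point_mass.
Proof.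
move=> /andP[c_gt0 c_le] cS; have bD : b \in (`]-oo, 1]%classic : set (measurableTypeR R)).
  by rewrite mem_setE in_itv/=.
split.
- split; first split.
  + by rewrite point_massE mem_setE in_itv/= andbT ltNge b_le1 mulr0.
  + by move=> a; rewrite point_massE ltry.
  exists b => x /(_ `]-oo, b[%classic) H; rewrite leNgt; apply/negP => xb.
  have ob : open (`]-oo, b[%classic : set R) by exact: itv_open_ends_open.
  have := H ob; rewrite /= in_itv/= => /(_ xb).
  by rewrite point_massE mem_setE in_itv/= ltxx mulr0 ltxx.
- by rewrite /total_mass point_massE bD mulr1 lte_fin lee_fin c_gt0.
- rewrite /static_moment integral_point_mass//; last first.
    by apply: measurable_funB => //; exact: measurable_cst.
  by rewrite bD mulr1 !lee_fin mulr_ge0// subr_ge0.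
Qed.

(** For the solution equal to 1 at the mass, the integral of [y] is [c], and the hypothesis is
    exactly the condition at the right end. *)
Lemma point_mass_quasi_eigenvalue (kappa : R[i]) : kappa != 0 ->
  1 - kappa ^+ 2 * (c%:num * (1 - b))%:C = - 'i * kappa * (c%:num)%:C ->
  quasi_eigenvalues point_mass kappa.
Proof.
move=> k0 kE; split => //.
(* A broken line: constant up to the mass, then of slope [- kappa ^+ 2 * c]. *)
pose y (x : R) : R[i] := 1 - kappa ^+ 2 * (c%:num * Num.max (x - b) 0)%:C.
have mmax (D : set (measurableTypeR R)) : measurable_fun D (fun x : R => Num.max (x - b) 0).
  by apply: measurable_maxr => //; apply: measurable_funB => //; exact: measurable_cst.
have yRe : (fun x => complex.Re (y x)) =
    fun x => 1 - complex.Re (kappa ^+ 2) * c%:num * Num.max (x - b) 0.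
  by apply/funext => x; rewrite /y /=; case: (kappa ^+ 2) => p q /=; ring.
have yIm : (fun x => complex.Im (y x)) =
    fun x => - complex.Im (kappa ^+ 2) * c%:num * Num.max (x - b) 0.
  by apply/funext => x; rewrite /y /=; case: (kappa ^+ 2) => p q /=; ring.
have mRe (D : set (measurableTypeR R)) : measurable_fun D (fun x : R => complex.Re (y x)).
  rewrite yRe; apply: measurable_funB; first exact: measurable_cst.
  by apply: measurable_funM; [exact: measurable_cst|exact: mmax].
have mIm (D : set (measurableTypeR R)) : measurable_fun D (fun x : R => complex.Im (y x)).
  by rewrite yIm; apply: measurable_funM; [exact: measurable_cst|exact: mmax].
have yb : y b = 1 by rewrite /y subrr maxxx !mulr0 subr0.
have cint x (g : R -> R) : measurable_fun (`]-oo, x]%classic : set (measurableTypeR R)) g ->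
  cintegral point_mass `]-oo, x]%classic (fun s => (g s)%:C * y s) =
  (c%:num * (b <= x)%R%:R * g b)%:C.
  move=> mg; rewrite /cintegral /Rintegral.
  have ReE s : complex.Re ((g s)%:C * y s) = g s * complex.Re (y s).
    by case: (y s) => p q /=; ring.
  have ImE s : complex.Im ((g s)%:C * y s) = g s * complex.Im (y s).
    by case: (y s) => p q /=; ring.
  under eq_integral do rewrite ReE.
  under [in X in _ +i* X]eq_integral do rewrite ImE.
  rewrite !integral_point_mass//; [|exact: measurable_funM..].
  by rewrite yb mem_setE in_itv/= mulr1 !mulr0.
have mx (D : set (measurableTypeR R)) (x : R) : measurable_fun D (fun s : R => x - s).
  by apply: measurable_funB => //; exact: measurable_cst.
exists y; split.
- split; first by split; exact: integrable_point_mass.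
  exists 1 => x x1; rewrite cint// {1}/y; congr (_ - _ * _%:C).
  case: (leP b x) => bx; first by rewrite max_l ?subr_ge0// mulr1.
  by rewrite max_r ?subr_le0 ?(ltW bx)// mulr0 mul0r.
- rewrite /right_slope.
  have -> : cintegral point_mass `]-oo, 1]%classic y = (c%:num)%:C.
    have := cint 1 (fun=> 1) (@measurable_cst _ _ _ _ _ _).
    rewrite b_le1 !mulr1 => <-.
    by congr (cintegral _ _ _); apply/funext => s; rewrite mul1r.
  have -> : 'i / kappa * (- kappa ^+ 2 * (c%:num)%:C) = - 'i * kappa * (c%:num)%:C by field.
  by rewrite -kE /y max_l// subr_ge0.
- by exists b => //; rewrite yb oner_neq0.
Qed.

End PointMass.

(** * Planar geometry and the values of the infimum *)

Lemma min_decay_ge {R : realType} (m S alpha L : R) :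
    (forall a b beta : R, 0 <= a <= S -> 0 <= b <= m ->
      1 = beta * b + (alpha ^+ 2 - beta ^+ 2) * a ->
      alpha * b = 2 * alpha * beta * a -> L <= beta) ->
  (L%:E <= min_decay m S alpha)%E.
Proof.
move=> HL; apply: le_ereal_inf_tmp => _ [kappa [alphaE [M [adM qM]]] <-].
rewrite lee_fin; rewrite -alphaE in HL.
by have [a [b [ha hb e1 e2]]] := admissible_moments adM qM; exact: HL ha hb e1 e2.
Qed.

(** Realised by the mass [mu] at distance [l] from the right end; the two equations are the real and
    imaginary parts of its characteristic equation. *)
Lemma min_decay_le {R : realType} (m S alpha beta mu l : R) :
    0 < mu <= m -> 0 <= l -> mu * l <= S ->
    1 = beta * mu + (alpha ^+ 2 - beta ^+ 2) * (mu * l) ->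
    alpha * mu = 2 * alpha * beta * (mu * l) ->
  (min_decay m S alpha <= beta%:E)%E.
Proof.
move=> /andP[mu_gt0 mu_le] l_ge0 muS e1 e2.
pose c := NngNum (ltW mu_gt0).
have b1 : 1 - l <= 1 by rewrite lerBlDr lerDl.
have lE : 1 - (1 - l) = l by ring.
apply: ereal_inf_lbound; exists (alpha +i* beta) => //; split => //.
exists (point_mass c (1 - l)); split.
  by apply: point_mass_admissible; rewrite //= ?mu_gt0// lE.
apply: point_mass_quasi_eigenvalue => //.
  apply/eqP => -[alpha0 beta0]; move: e1; rewrite alpha0 beta0.
  by rewrite expr0n/= subrr !mul0r addr0 => /eqP; rewrite oner_eq0.
rewrite lE expr2 /=; apply/eqP; rewrite eq_complex /=; apply/andP; split; apply/eqP.
  by transitivity (1 - (alpha ^+ 2 - beta ^+ 2) * (mu * l)); [ring|rewrite {1}e1; ring].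
by transitivity (- (2 * alpha * beta * (mu * l))); [ring|rewrite -e2; ring].
Qed.

(** Writing [n] for the squared modulus of kappa, the moments [a = 1 / n] and [b = 2 * beta / n]
    solve both equations; the two inequalities say [a <= S] and [b <= m]. The distance of the mass
    is [a / b]. *)
Lemma min_decay_le_disc {R : realType} (m S alpha beta : R) : 0 < S ->
    0 < beta -> S^-1 <= alpha ^+ 2 + beta ^+ 2 ->
    2 * beta <= m * (alpha ^+ 2 + beta ^+ 2) ->
  (min_decay m S alpha <= beta%:E)%E.
Proof.
move=> S0 b0 hS hm; set n := alpha ^+ 2 + beta ^+ 2 in hS hm.
have n0 : 0 < n by rewrite ltr_wpDl ?sqr_ge0 ?exprn_gt0.
have e : 2 * beta / n * (2 * beta)^-1 = n^-1 by field; rewrite !gt_eqF.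
apply: (@min_decay_le _ _ _ _ _ (2 * beta / n) (2 * beta)^-1).
- by rewrite divr_gt0 ?mulr_gt0// ler_pdivrMr.
- by rewrite invr_ge0 mulr_ge0// ltW.
- by rewrite e -[S]invrK lef_pV2 ?posrE ?invr_gt0.
- by rewrite e /n; field; rewrite gt_eqF.
- by rewrite e /n; field; rewrite gt_eqF.
Qed.

(** For nonzero [alpha] the second equation gives [b = 2 * beta * a], and the first becomes
    [n * a = 1]. The bounds on [a] and [b] thus place kappa outside both discs. *)
Lemma moments_bounds {R : realType} (m S alpha beta a b : R) : 0 < S ->
    alpha != 0 -> 0 <= a <= S -> 0 <= b <= m ->
    1 = beta * b + (alpha ^+ 2 - beta ^+ 2) * a -> alpha * b = 2 * alpha * beta * a ->
  [/\ 0 <= beta, S^-1 <= alpha ^+ 2 + beta ^+ 2 &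
      2 * beta <= m * (alpha ^+ 2 + beta ^+ 2)].
Proof.
move=> S0 alpha0 /andP[a0 aS] /andP[b0 bm] e1 e2.
have bE : b = 2 * beta * a by apply: (mulfI alpha0); rewrite e2; ring.
set n := alpha ^+ 2 + beta ^+ 2.
have nE : n * a = 1 by rewrite [RHS]e1 bE /n; ring.
have n0 : 0 < n by rewrite /n ltr_pwDl ?sqr_ge0// exprn_even_gt0.
have {}a0 : 0 < a by rewrite -(pmulr_rgt0 _ n0) nE.
have aE : a = n^-1 by apply: (mulfI (lt0r_neq0 n0)); rewrite nE divff ?gt_eqF.
split.
- have : 0 <= (2 * a) * beta by rewrite mulrAC -bE.
  by rewrite pmulr_rge0// mulr_gt0.
- by rewrite -[n]invrK lef_pV2 ?posrE ?invr_gt0// -aE.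
- by rewrite -ler_pdivrMr// -aE -bE.
Qed.

Lemma le_sqrtl {R : realType} (x y : R) : 0 <= y -> x <= y ^+ 2 -> Num.sqrt x <= y.
Proof. by move=> y0 xy; rewrite -[y]ger0_norm// -sqrtr_sqr ler_sqrt// sqr_ge0. Qed.

(** On the imaginary axis the second equation is void, and [1 <= beta * b <= beta * m]. Equality
    holds for the whole mass [m] placed at the right end. *)
Lemma min_decay_zero {R : realType} (m S : R) : 0 < m -> 0 < S ->
  min_decay m S 0 = (m^-1)%:E.
Proof.
move=> m0 S0; apply/eqP; rewrite eq_le; apply/andP; split.
  apply: (@min_decay_le _ _ _ _ _ m 0) => //; first by rewrite m0 lexx.
  - by rewrite mulr0 ltW.
  - by rewrite mulr0 mulr0 addr0 mulVf ?gt_eqF.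
  - by rewrite !(mul0r, mulr0).
apply: min_decay_ge => a b beta /andP[a0 _] /andP[b0 bm] e1 _.
have h1 : 1 <= beta * b by rewrite e1 expr0n/= sub0r mulNr gerDl oppr_le0 mulr_ge0 ?sqr_ge0.
have beta0 : 0 < beta.
  by rewrite ltNge; apply/negP => /mulr_le0_ge0 /(_ b0) /(le_trans h1); rewrite ler10.
by rewrite -div1r ler_pdivrMr// (le_trans h1)// ler_wpM2l// ltW.
Qed.

Lemma min_decay_large {R : realType} (m S alpha : R) : 0 < m -> 0 < S ->
  Num.sqrt S^-1 <= `|alpha| -> min_decay m S alpha = 0%:E.
Proof.
move=> m0 S0; rewrite -sqrtr_sqr ler_sqrt ?sqr_ge0// => hS.
have a2 : 0 < alpha ^+ 2 by rewrite (lt_le_trans _ hS)// invr_gt0.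
have alpha0 : alpha != 0 by apply: contraTN a2 => /eqP ->; rewrite expr0n ltxx.
apply/eqP; rewrite eq_le; apply/andP; split; last first.
  by apply: min_decay_ge => a b beta ha hb e1 e2; have [] := moments_bounds S0 alpha0 ha hb e1 e2.
apply/lee_addgt0Pr => e e0; rewrite add0e.
(* The second bound ensures [2 * beta <= m * alpha ^+ 2], which keeps kappa outside the disc around
   [i / m]. *)
pose beta := Num.min e (m * alpha ^+ 2 / 2).
have beta0 : 0 < beta by rewrite lt_min e0 divr_gt0// mulr_gt0.
apply: (@le_trans _ _ beta%:E); last by rewrite lee_fin /beta ge_min lexx.
apply: min_decay_le_disc => //.
  by rewrite (le_trans hS)// lerDl sqr_ge0.
have : beta <= m * alpha ^+ 2 / 2 by rewrite /beta ge_min lexx orbT.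
rewrite ler_pdivlMr// mulrC => /le_trans; apply.
by rewrite ler_pM2l// lerDl sqr_ge0.
Qed.

(** The lower bound comes from the disc around 0. On its circle the other condition reads
    [beta <= m / (2 * S)], which is the assumed lower bound on [alpha ^+ 2]. *)
Lemma min_decay_circle {R : realType} (m S alpha : R) : 0 < m -> 0 < S ->
    alpha != 0 -> S^-1 - m ^+ 2 * S ^- 2 / 4 <= alpha ^+ 2 -> `|alpha| <= Num.sqrt S^-1 ->
  min_decay m S alpha = (Num.sqrt (S^-1 - alpha ^+ 2))%:E.
Proof.
move=> m0 S0 alpha0 h1; rewrite -sqrtr_sqr ler_sqrt ?invr_ge0 ?(ltW S0)// => h2.
(* At the endpoint [alpha ^+ 2 = S^-1] the candidate has [beta = 0], which no point mass
   construction with positive [beta] reaches. *)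
have [h3|] := ltP (alpha ^+ 2) S^-1; last first.
  move=> h3; rewrite (le_anti (introT andP (conj h2 h3))) subrr sqrtr0.
  by apply: min_decay_large => //; rewrite -sqrtr_sqr ler_sqrt ?sqr_ge0.
apply/eqP; rewrite eq_le; apply/andP; split; last first.
  apply: min_decay_ge => a b beta ha hb e1 e2.
  have [b0 hs _] := moments_bounds S0 alpha0 ha hb e1 e2.
  by apply: le_sqrtl => //; rewrite lerBlDl.
have d0 : 0 < S^-1 - alpha ^+ 2 by rewrite subr_gt0.
have sE : alpha ^+ 2 + Num.sqrt (S^-1 - alpha ^+ 2) ^+ 2 = S^-1.
  by rewrite sqr_sqrtr ?ltW//; ring.
apply: min_decay_le_disc => //; rewrite ?sqrtr_gt0// sE// mulrC -ler_pdivlMr//.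
apply: le_sqrtl; first by rewrite ltW// divr_gt0// divr_gt0.
apply: (@le_trans _ _ (m ^+ 2 * S ^- 2 / 4)); first by move: h1; lra.
by rewrite le_eqVlt; apply/orP; left; apply/eqP; field; rewrite gt_eqF.
Qed.

(** The value is the height of the upper arc of the circle around [i / m]. Points below its lower
    arc are excluded because they fall into the disc around 0. *)
Lemma min_decay_arc {R : realType} (m S alpha : R) : 0 < m -> m ^+ 2 / 4 < S ->
    alpha != 0 -> `|alpha| < Num.sqrt (S^-1 - m ^+ 2 * S ^- 2 / 4) ->
  min_decay m S alpha = (m^-1 + Num.sqrt (m ^- 2 - alpha ^+ 2))%:E.
Proof.
move=> m0 mS alpha0.
have S0 : 0 < S by apply: le_lt_trans mS; rewrite divr_ge0// sqr_ge0.
set s := S^-1; set k := m^-1.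
have s0 : 0 < s by rewrite invr_gt0.
have k0 : 0 < k by rewrite invr_gt0.
have mk : m * k = 1 by rewrite divff ?gt_eqF.
have -> : m ^- 2 = k ^+ 2 by rewrite exprVn.
have -> : S ^- 2 = s ^+ 2 by rewrite exprVn.
have T0 : 0 < s - m ^+ 2 * s ^+ 2 / 4.
  have -> : s - m ^+ 2 * s ^+ 2 / 4 = s ^+ 2 * (S - m ^+ 2 / 4).
    by rewrite /s; field; rewrite gt_eqF.
  by rewrite mulr_gt0 ?exprn_gt0// subr_gt0.
rewrite -sqrtr_sqr ltr_sqrt// => hT.
(* The two circles meet at height [m * s / 2], with [alpha ^+ 2] equal to the threshold. The bound
   on [alpha] therefore puts this height strictly between [k - r] and [k + r]. *)
have TE : k ^+ 2 - (s - m ^+ 2 * s ^+ 2 / 4) = (k - m * s / 2) ^+ 2.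
  transitivity (k ^+ 2 - (m * k) * s + m ^+ 2 * s ^+ 2 / 4); last by field.
  by rewrite mk; ring.
have k2 : alpha ^+ 2 < k ^+ 2.
  by apply: lt_le_trans hT _; rewrite -subr_ge0 TE sqr_ge0.
set r := Num.sqrt (k ^+ 2 - alpha ^+ 2).
have r0 : 0 < r by rewrite sqrtr_gt0 subr_gt0.
have rE : r ^+ 2 = k ^+ 2 - alpha ^+ 2 by rewrite sqr_sqrtr// subr_ge0 ltW.
have r_gt : (k - m * s / 2) ^+ 2 < r ^+ 2 by rewrite rE -TE; lra.
have {r_gt} : `|k - m * s / 2| < r.
  by rewrite -(ltr_pXn2r (n := 2)) ?nnegrE ?normr_ge0 ?(ltW r0)// real_normK ?num_real.
rewrite ltr_norml => /andP[r_gt1 r_gt2].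
apply/eqP; rewrite eq_le; apply/andP; split.
  (* On the circle around [i * k] the squared modulus is [2 * k] times the height. *)
  have nE : alpha ^+ 2 + (k + r) ^+ 2 = 2 * k * (k + r).
    have -> : alpha ^+ 2 = k ^+ 2 - r ^+ 2 by rewrite rE; ring.
    by ring.
  apply: min_decay_le_disc => //; rewrite ?addr_gt0// nE.
    have -> : S^-1 = 2 * k * (m * s / 2).
      transitivity (m * k * s); first by rewrite mk mul1r.
      by field.
    by rewrite ler_pM2l ?mulr_gt0//; lra.
  by rewrite !mulrA (mulrC m) -(mulrA 2) mk mulr1.
apply: min_decay_ge => a b beta ha hb e1 e2.
have [b0 hs hm] := moments_bounds S0 alpha0 ha hb e1 e2.
have hd : r ^+ 2 <= (beta - k) ^+ 2.
  have : 2 * k * beta <= alpha ^+ 2 + beta ^+ 2.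
    rewrite -(ler_pM2l m0); apply: le_trans hm.
    by rewrite !mulrA (mulrC m) -(mulrA 2) mk mulr1.
  by rewrite rE => h; rewrite sqrrB; move: h; lra.
rewrite leNgt; apply/negP => lt_beta.
(* Between [k] and [k + r] the point is inside the disc around [i * k]; below [k] it must be at
   height at most [k - r], where its squared modulus is less than [s]. *)
have [kb|bk] := leP k beta.
  have : (beta - k) ^+ 2 < r ^+ 2.
    by rewrite ltr_pXn2r ?nnegrE ?subr_ge0 ?(ltW r0)//; lra.
  by rewrite ltNge hd.
have rk : r <= k - beta.
  rewrite -(ler_pXn2r (n := 2)) ?nnegrE ?(ltW r0)//; last by lra.
  by rewrite -[k - beta]opprB sqrrN.
have : beta ^+ 2 <= (k - r) ^+ 2.
  by rewrite ler_pXn2r ?nnegrE//; lra.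
have yE : alpha ^+ 2 + (k - r) ^+ 2 = 2 * k * (k - r).
  have -> : alpha ^+ 2 = k ^+ 2 - r ^+ 2 by rewrite rE; ring.
  by ring.
have : 2 * k * (k - r) < 2 * k * (m * s / 2).
  by rewrite ltr_pM2l ?mulr_gt0//; lra.
have -> : 2 * k * (m * s / 2) = s.
  by transitivity (m * k * s); [field|rewrite mk mul1r].
by rewrite -yE => h1 h2; move: hs; rewrite -/s; lra.
Qed.

Theorem corollary2p2 (R : realType) (m S : R) (m_gt0 : 0 < m) (S_gt0 : 0 < S) :
  (S <= m ^+ 2 / 4 -> forall alpha : R,
    [/\ alpha = 0 ->
          min_decay m S alpha = (m^-1)%:E,
        0 < `|alpha| <= Num.sqrt S^-1 ->
          min_decay m S alpha = (Num.sqrt (S^-1 - alpha ^+ 2))%:E &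
        Num.sqrt S^-1 <= `|alpha| ->
          min_decay m S alpha = 0%:E]) /\
  (m ^+ 2 / 4 < S -> forall alpha : R,
    [/\ alpha = 0 ->
          min_decay m S alpha = (m^-1)%:E,
        0 < `|alpha| < Num.sqrt (S^-1 - m ^+ 2 * S ^- 2 / 4) ->
          min_decay m S alpha = (m^-1 + Num.sqrt (m ^- 2 - alpha ^+ 2))%:E,
        Num.sqrt (S^-1 - m ^+ 2 * S ^- 2 / 4) <= `|alpha| <= Num.sqrt S^-1 ->
          min_decay m S alpha = (Num.sqrt (S^-1 - alpha ^+ 2))%:E &
        Num.sqrt S^-1 <= `|alpha| ->
          min_decay m S alpha = 0%:E]).
Proof.
have norm_gt0 (alpha : R) : 0 < `|alpha| -> alpha != 0 by rewrite normr_gt0.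
split=> mS alpha; split.
- by move=> ->; exact: min_decay_zero.
- move=> /andP[/norm_gt0 alpha0 alpha_le]; apply: min_decay_circle => //.
  (* For [S <= m ^+ 2 / 4] the threshold is at most 0, so the circle formula covers every nonzero
     [alpha] in range. *)
  apply: le_trans (sqr_ge0 alpha); rewrite subr_le0.
  have -> : m ^+ 2 * S ^- 2 / 4 = S ^- 2 * (m ^+ 2 / 4) by ring.
  apply: (@le_trans _ _ (S ^- 2 * S)); last by rewrite ler_pM2l// invr_gt0 exprn_gt0.
  by rewrite le_eqVlt; apply/orP; left; apply/eqP; field; rewrite gt_eqF.
- exact: min_decay_large.
- by move=> ->; exact: min_decay_zero.
- by move=> /andP[/norm_gt0 alpha0 alpha_lt]; exact: min_decay_arc.
- move=> /andP[]; set T := S^-1 - _ => hT alpha_le.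
  (* Positivity of the threshold is what makes [alpha] nonzero here. *)
  have T0 : 0 < T.
    have -> : T = S ^- 2 * (S - m ^+ 2 / 4) by rewrite /T; field; rewrite gt_eqF.
    by rewrite mulr_gt0 ?invr_gt0 ?exprn_gt0// subr_gt0.
  have hT2 : T <= alpha ^+ 2 by move: hT; rewrite -sqrtr_sqr ler_sqrt ?sqr_ge0.
  apply: min_decay_circle => //; apply: contraTneq hT2 => ->.
  by rewrite expr0n -ltNge.
- exact: min_decay_large.
Qed.
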